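(* Let $q$ be an odd prime power and let $a,b\in\mathbb{F}_q^*$. Write \[ D:=\{x\in\mathbb{F}_q : \chi(x)=\chi(a)\ \text{and}\ \chi(x+1)=\chi(b)\}. \] Let $k$ be an integer not divisible by $(q-1)/2$, and let $\ell$ and $\varepsilon$ be the unique integers such that $k\equiv \varepsilon\ell \pmod{q-1}$, $\varepsilon\in\{1,-1\}$, and $0<\ell<(q-1)/2$. Then, in $\mathbb{F}_q$, \[ \sum_{x\in D} x^k = \frac{1+\chi(-a)+2^{-\ell}\cdot\chi(c)\cdot\sum_{i=0}^{\lfloor \ell/2\rfloor} 4^{-i}\binom{\ell}{2i}\binom{2i}{i}}{4\cdot(-1)^{\ell+1}}, \] where $c:=ab$ if $\varepsilon=1$ and $c:=b$ if $\varepsilon=-1$. In particular, if $q>3$ then \[ \sum_{x\in D} x = \frac{1+\chi(-a)}{4}+\frac{\chi(ab)}{8}, \] and if $q>5$ then \[ \sum_{x\in D} x^2 = \frac{-1-\chi(-a)}{4}-3\cdot\frac{\chi(ab)}{32}. \]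
   Context: For an odd prime power $q$, $\chi$ denotes the quadratic character on $\mathbb{F}_q$, defined by $\chi(x):=x^{(q-1)/2}\in\mathbb{F}_q$; thus $\chi(x)=1$ if $x$ is a nonzero square, $\chi(x)=-1$ if $x$ is a nonsquare, and $\chi(0)=0$. Integers and rational numbers with denominators prime to the characteristic are interpreted as elements of $\mathbb{F}_q$. *)

(* Defs.v *)
From mathcomp Require Import all_boot all_order all_algebra.

Set Implicit Arguments.
Unset Strict Implicit.
Unset Printing Implicit Defensive.

Import GRing.Theory.
Local Open Scope ring_scope.

Definition chi (F : finFieldType) (x : F) : F := x ^+ (#|F|.-1)./2.

Definition Dset (F : finFieldType) (a b : F) : {set F} :=
  [set x | (chi x == chi a) && (chi (x + 1) == chi b)].

Definition signed_residue (q : nat) (k : int) (l : nat) (eps : int) : Prop :=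
  [/\ (k = eps * l%:Z %[mod q.-1%:Z])%Z,
      eps = 1 \/ eps = -1
    & (0 < l < (q.-1)./2)%N].

(* Main.v *)
Require Import Defs.
From mathcomp Require Import all_boot all_order all_algebra all_field.
From mathcomp Require Import ring zify.

(** Let [m = (q - 1)/2]. On nonzero [y] the indicator of [chi y = chi a] is
    [(1 + chi (a y)) / 2], so four times the sum of [x^k] over [D] is, up to a
    correction at [x = -1], a combination of the sums of [x^n] and
    [x^n (x + 1)^m] over the nonzero [x]. Since the power sum of exponent [n] is
    [-1] if [q - 1] divides [n] and [0] otherwise, only one term
    [- chi c * binom(m, l)] survives. In the field, [binom(m, l)] equals
    [(-4)^(-l) binom(2l, l)]: both [u_l = (-4)^l binom(m, l)] and
    [v_l = binom(2l, l)] have self-convolution [4^n] (for [u] because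
    [binom(q - 1, n) = (-1)^n] in the field), and a sequence starting at [1] is
    determined by its self-convolution when [2 <> 0]. Finally [binom(2l, l)] is
    the middle coefficient of [(1 + 2X + X^2)^l], which gives the stated sum. *)

Import GRing.Theory.
Local Open Scope ring_scope.

(** * Central binomial coefficients and their self-convolution *)

Lemma mul_central_bin i :
  (i.+1 * 'C(2 * i.+1, i.+1) = (4 * i + 2) * 'C(2 * i, i))%N.
Proof.
have h1 := mul_bin_diag (2 * i.+1) i.
have h2 := mul_bin_diag (2 * i).+1 i.
have h3 : 'C((2 * i).+1, i) = 'C((2 * i).+1, i.+1).
  by rewrite -[LHS]bin_sub; [congr binomial|]; lia.
have e : (2 * i.+1).-1 = (2 * i).+1 by lia.
rewrite e h3 in h1; rewrite /= in h2.
apply/eqP; rewrite -(eqn_pmul2l (ltn0Sn i)) -h1; apply/eqP.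
nia.
Qed.

(* Weighting the sum by [i] and symmetrising [i <-> n - i] turns
   [mul_central_bin] into a first-order recurrence for the sum. *)
Lemma sum_central_bin n :
  (\sum_(i < n.+1) 'C(2 * i, i) * 'C(2 * (n - i), n - i) = 4 ^ n)%N.
Proof.
pose A k := (\sum_(i < k.+1) 'C(2 * i, i) * 'C(2 * (k - i), k - i))%N.
pose B k := (\sum_(i < k.+1) i * ('C(2 * i, i) * 'C(2 * (k - i), k - i)))%N.
have BA k : (2 * B k = k * A k)%N.
  rewrite mul2n -addnn {2}/B (reindex_inj rev_ord_inj) /= -big_split big_distrr /=.
  apply: eq_bigr => i _; have ik := ltn_ord i.
  by rewrite !subSS subKn // [(_ * 'C(2 * i, i))%N]mulnC -mulnDl subnKC.
rewrite -/(A n); elim: n => [|n IHn]; first by rewrite /A big_ord1.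
apply/eqP; rewrite -(eqn_pmul2l (ltn0Sn n)) -BA /B big_ord_recl mul0n add0n.
(* The weight kills the term of index [0]; [mul_central_bin] then turns the weighted term of index
   [i + 1] into terms of [B n] and [A n]. *)
rewrite (eq_bigr (fun i : 'I_n.+1 =>
  (4 * (i * ('C(2 * i, i) * 'C(2 * (n - i), n - i))) +
   2 * ('C(2 * i, i) * 'C(2 * (n - i), n - i)))%N)).
  rewrite big_split -!big_distrr /= -/(A n) -/(B n) IHn expnS.
  by apply/eqP; move: (BA n); rewrite IHn; nia.
move=> i _; rewrite /= /bump leq0n !add1n subSS mulnA mul_central_bin.
by ring.
Qed.

(** * Middle coefficients of polynomial powers *)

Lemma big_nat_even (R : nmodType) (f : nat -> R) n :
    (forall j, odd j -> f j = 0) ->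
  \sum_(0 <= j < n.+1) f j = \sum_(0 <= i < n./2.+1) f (2 * i)%N.
Proof.
move=> f0; elim: n => [|n IHn]; first by rewrite !big_nat1.
rewrite big_nat_recr //= IHn uphalf_half.
have [on|en] := boolP (odd n).
  rewrite add1n [RHS]big_nat_recr //=; congr (_ + f _).
  by rewrite mul2n doubleS -[in LHS](odd_double_half n) on.
by rewrite add0n f0 ?addr0 //= en.
Qed.

Lemma coef_X2D1_exp (R : comNzRingType) j :
  (('X^2 + 1 : {poly R}) ^+ j)`_j = if odd j then 0 else 'C(j, j./2)%:R.
Proof.
rewrite exprD1n coef_sum; under eq_bigr => i _ do rewrite -exprM coefMn coefXn.
case: ifP => oj.
  rewrite big1 // => i _.
  by have -> : (j == 2 * i)%N = false; [lia | rewrite mul0rn].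
have lj : (j./2 < j.+1)%N by lia.
rewrite (bigD1 (Ordinal lj)) //= big1 ?addr0 => [|i /eqP ni].
  by have -> : (j == 2 * j./2)%N by lia.
case: eqP => [ej|]; last by rewrite mul0rn.
by case: ni; apply: val_inj => /=; lia.
Qed.

(* Compares the middle coefficients of [(X + 1)^(2l)] and [((X^2 + 1) + 2X)^l]. *)
Lemma central_bin_sum (R : comNzRingType) l :
  'C(2 * l, l)%:R = \sum_(0 <= i < l./2.+1)
     2 ^+ (l - 2 * i) * 'C(l, 2 * i)%:R * 'C(2 * i, i)%:R :> R.
Proof.
pose f j : R := if odd j then 0 else
  2 ^+ (l - j) * 'C(l, j)%:R * 'C(j, j./2)%:R.
transitivity (\sum_(0 <= i < l./2.+1) f (2 * i)%N); last first.
  by apply: eq_bigr => i _; rewrite /f mul2n odd_double doubleK.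
rewrite -big_nat_even => [|j oj]; last by rewrite /f oj.
have -> : 'C(2 * l, l)%:R = (('X + 1 : {poly R}) ^+ (2 * l))`_l.
  rewrite exprD1n coef_sum.
  have ll : (l < (2 * l).+1)%N by lia.
  rewrite (bigD1 (Ordinal ll)) //= coefMn coefXn eqxx big1 ?addr0 // => i /eqP ni.
  rewrite coefMn coefXn; case: eqP => [el|]; last by rewrite mul0rn.
  by case: ni; apply: val_inj.
have -> : ('X + 1 : {poly R}) ^+ (2 * l) = ('X *+ 2 + ('X^2 + 1)) ^+ l.
  by rewrite exprM; congr (_ ^+ _); ring.
rewrite exprDn coef_sum big_mkord; apply: eq_bigr => j _.
have jl : (j <= l)%N by have := ltn_ord j.
rewrite exprMn_n mulrnAl !coefMn coefXnM ltnNge leq_subr /= subKn // coef_X2D1_exp.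
rewrite /f; case: ifP => _; first by rewrite !mul0rn.
by rewrite -[_ *+ 'C(l, j)]mulr_natr -[_ *+ (2 ^ _)]mulr_natr natrX; ring.
Qed.

(** * Power sums over a finite field *)

(** Translation by [1] permutes [F], so adding [1] to every element leaves the total unchanged. *)
Lemma natr_card (F : finFieldType) : #|F|%:R = 0 :> F.
Proof.
have : \sum_(x : F) x = \sum_(x : F) (x + 1).
  by rewrite [LHS](reindex_inj (addIr 1)).
rewrite big_split /= sumr_const => h.
by apply: (@addrI _ (\sum_(x : F) x)); rewrite -h addr0.
Qed.

Lemma two_neq0 (F : finFieldType) : odd #|F| -> 2 != 0 :> F.
Proof.
move=> oF; apply/eqP => F2; have /eqP := natr_card F; apply/negP.
by rewrite -(odd_double_half #|F|) oF -mul2n natrD natrM F2 mul0r addr0 oner_neq0.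
Qed.

Lemma expf_pred_card (F : finFieldType) (x : F) : x != 0 -> x ^+ #|F|.-1 = 1.
Proof.
move=> nz_x; apply: (mulfI nz_x).
by rewrite -exprS prednK ?expf_card ?mulr1 // ltnW ?finRing_gt1.
Qed.

(** Substituting [g x] multiplies the sum by [g^n], and some [g <> 0] has [g^n <> 1]: with
    [r = n mod (q - 1)] nonzero, [X^r - 1] has at most [r < q - 1] roots. *)
Lemma sum_expf0 (F : finFieldType) n :
  ~~ (#|F|.-1 %| n)%N -> \sum_(x : F | x != 0) x ^+ n = 0.
Proof.
move=> ndv; have F1 : (1 < #|F|)%N := finRing_gt1 F; set r := (n %% #|F|.-1)%N.
have r0 : (0 < r)%N by rewrite lt0n.
have rlt : (r < #|F|.-1)%N by rewrite ltn_mod; lia.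
have [g /andP[nz_g gr]] : exists g : F, (g != 0) && (g ^+ r != 1).
  apply/existsP; rewrite -[X in is_true X]negbK negb_exists; apply/negP => /forallP H.
  have := @max_unity_roots F r (enum (predC1 (0 : F))) r0.
  rewrite -cardE cardC1 enum_uniq => /(_ _ isT).
  rewrite leqNgt rlt => H1; suff: false by []; apply: H1.
  apply/allP => x; rewrite mem_enum inE => nz_x.
  by have := H x; rewrite nz_x /= negbK unity_rootE.
set S := \sum_(x | _) _.
have : S = g ^+ n * S.
  rewrite {1}/S (reindex_inj (mulfI nz_g)) big_distrr /=.
  by apply: eq_big => [x|x _]; rewrite ?mulf_eq0 ?(negPf nz_g) // exprMn.
move/eqP; rewrite -subr_eq0 -{1}[S]mul1r -mulrBl mulf_eq0 => /orP[|/eqP //].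
by rewrite subr_eq0 -(expr_mod _ (@expf_pred_card F g nz_g)) eq_sym (negPf gr).
Qed.

Lemma sum_expf_dvd (F : finFieldType) n :
  (#|F|.-1 %| n)%N -> \sum_(x : F | x != 0) x ^+ n = -1.
Proof.
case/dvdnP=> k ->; rewrite (eq_bigr (fun=> 1)) => [|x nz_x]; last first.
  by rewrite mulnC exprM expf_pred_card // expr1n.
rewrite sumr_const cardC1; apply: (addIr 1).
by rewrite addNr natr1 prednK ?natr_card // ltnW ?finRing_gt1.
Qed.

(** After expanding [(x + 1)^N], the power sum of exponent [n + i] survives only if [q - 1] divides
    [n + i]; the bounds leave only [n + i = q - 1]. *)
Lemma sum_expfM_exp1 (F : finFieldType) n N :
    (0 < n < #|F|.-1)%N -> (n + N < 2 * #|F|.-1)%N ->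
  \sum_(x : F | x != 0) x ^+ n * (x + 1) ^+ N = - 'C(N, #|F|.-1 - n)%:R.
Proof.
set Q := #|F|.-1 => nQ nN.
under eq_bigr => x _ do rewrite exprD1n big_distrr /=.
rewrite exchange_big /=.
under eq_bigr => i _ do under eq_bigr => x _ do rewrite mulrnAr -exprD.
under eq_bigr => i _ do rewrite sumrMnl.
have ndv i : (i < N.+1)%N -> (i != Q - n)%N -> ~~ (Q %| n + i)%N.
  move=> iN iQ; apply/negP => /dvdnP[[|[|t]]]; nia.
have [le|lt] := leqP (Q - n) N; last first.
  rewrite bin_small // oppr0 big1 // => i _; rewrite sum_expf0 ?mul0rn //.
  by apply: ndv => //; have := ltn_ord i; lia.
rewrite (bigD1 (Ordinal (le : (Q - n < N.+1)%N))) //= sum_expf_dvd; last first.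
  by rewrite subnKC //; lia.
rewrite mulNrn big1 ?addr0 // => i ni.
by rewrite sum_expf0 ?mul0rn // ndv.
Qed.

(** For [0 < j < Q = q - 1], the sum of [x^(Q - j) (x + 1)^Q] over nonzero [x] is [- 'C(Q, j)] by
    expansion; directly, [(x + 1)^Q] is [1] except at [x = -1], so it is a vanishing power sum minus
    [(-1)^(Q - j)]. *)
Lemma bin_pred_card (F : finFieldType) j :
  (j < #|F|)%N -> 'C(#|F|.-1, j)%:R = (-1) ^+ j :> F.
Proof.
have F1 : (1 < #|F|)%N := finRing_gt1 F; move=> jF.
have N1nz : (-1 : F) != 0 by rewrite oppr_eq0 oner_neq0.
have [->|j0] := posnP j; first by rewrite bin0.
have [->|jQ] := eqVneq j #|F|.-1; first by rewrite binn expf_pred_card.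
set Q := #|F|.-1 in jQ *; have jlt : (j < Q)%N by lia.
have := @sum_expfM_exp1 F (Q - j) Q; rewrite -/Q (subKn (ltnW jlt)).
move=> /(_ ltac:(lia) ltac:(lia)) h.
rewrite -['C(_, _)%:R]opprK -h (bigD1 (-1)) //= addNr expr0n.
have -> : (Q == 0)%N = false by lia.
rewrite mulr0 add0r (eq_bigr (fun x => x ^+ (Q - j))); last first.
  move=> x /andP[nz_x x1]; rewrite [(x + 1) ^+ Q]expf_pred_card ?mulr1 //.
  by rewrite addr_eq0.
have := @sum_expf0 F (Q - j).
rewrite -/Q (bigD1 (-1)) //= => /(_ ltac:(rewrite gtnNdvd; lia)).
move/eqP; rewrite addr_eq0 => /eqP <-.
apply: (mulfI (expf_neq0 j N1nz)); rewrite -exprD (subnKC (ltnW jlt)) expf_pred_card //.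
by rewrite -expr2 -exprM mulnC exprM sqrrN !expr1n.
Qed.

(** * The value of ['C(m, l)] in the field *)

(** For [N > 0] the convolution at [N] is [2 u_N] plus products of terms of index from [1] to
    [N - 1], so induction leaves only a cancellation of [2]. *)
Lemma convolution_sqr_inj (R : idomainType) (u v : nat -> R) N :
    2 != 0 :> R -> u 0%N = 1 -> v 0%N = 1 ->
    (forall n, (n <= N)%N -> \sum_(i < n.+1) u i * u (n - i)%N =
                             \sum_(i < n.+1) v i * v (n - i)%N) ->
  u N = v N.
Proof.
move=> R2 u0 v0; elim/ltn_ind: N => -[|N] IHN eq_uv; first by rewrite u0 v0.
have eqk k : (k <= N)%N -> u k = v k.
  by move=> kN; apply: IHN => // n nk; apply: eq_uv; lia.
have := eq_uv N.+1 (leqnn _).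
rewrite big_ord_recl big_ord_recr [RHS]big_ord_recl [X in _ = _ + X]big_ord_recr /=.
rewrite subn0 /bump leq0n add1n subnn u0 v0 !mulr1 !mul1r.
rewrite [X in _ + (X + _) = _](eq_bigr (fun i : 'I_N => v i.+1 * v (N.+1 - i.+1)%N)).
  by rewrite addrCA [RHS]addrCA => /addrI; rewrite -!mulr2n
    -[u _ *+ 2]mulr_natl -[v _ *+ 2]mulr_natl => /(mulfI R2).
move=> i _; rewrite leq0n add1n; have iN := ltn_ord i.
by rewrite !eqk //; lia.
Qed.

(* With [2m = q - 1], this is [binom(m, l) = binom(-1/2, l)] in characteristic p. *)
Lemma bin_half_card (F : finFieldType) l : odd #|F| -> (l < #|F|)%N ->
  (-4) ^+ l * 'C(#|F|.-1./2, l)%:R = 'C(2 * l, l)%:R :> F.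
Proof.
move=> oF lF; set m := #|F|.-1./2.
apply: (@convolution_sqr_inj F (fun i => (-4) ^+ i * 'C(m, i)%:R)
  (fun i => 'C(2 * i, i)%:R)); rewrite ?two_neq0 ?bin0 ?mulr1 //.
move=> n nl.
have -> : \sum_(i < n.+1) 'C(2 * i, i)%:R * 'C(2 * (n - i), n - i)%:R = 4 ^+ n :> F.
  rewrite -natrX -sum_central_bin natr_sum.
  by apply: eq_bigr => i _; rewrite natrM.
transitivity ((-4) ^+ n * 'C(m + m, n)%:R : F).
  rewrite -binomial.Vandermonde natr_sum big_distrr; apply: eq_bigr => i _ /=.
  have ni : (i <= n)%N by have := ltn_ord i.
  have -> : (-4) ^+ n = (-4) ^+ i * (-4) ^+ (n - i) :> F by rewrite -exprD subnKC.
  by rewrite natrM; ring.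
have -> : (m + m = #|F|.-1)%N by rewrite /m; lia.
rewrite bin_pred_card; last by lia.
by rewrite -exprMn; congr (_ ^+ _); ring.
Qed.

(** * The quadratic character and sums over [Dset] *)

Lemma chiM (F : finFieldType) (x y : F) : chi (x * y) = chi x * chi y.
Proof. exact: exprMn. Qed.

Lemma chi_neq0 (F : finFieldType) (x : F) :
  odd #|F| -> x != 0 -> chi x = 1 \/ chi x = -1.
Proof.
move=> oF nz_x; have /eqP : chi x ^+ 2 = 1.
  by rewrite /chi -exprM -(expf_pred_card F x nz_x); congr (_ ^+ _); lia.
by rewrite sqrf_eq1 => /orP[]/eqP; [left|right].
Qed.

(* [(1 + chi x chi a) / 2] is the indicator of [chi x = chi a] on nonzero elements;
   expanding the product of two such factors over [x != 0] miscounts only [x = -1]. *)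
Lemma sum_Dset (F : finFieldType) (a b : F) r :
    let m := #|F|.-1./2 in
    odd #|F| -> a != 0 -> b != 0 -> (0 < m)%N -> ~~ (m %| r)%N ->
  4 * \sum_(x in Dset a b) x ^+ r =
    chi b * (\sum_(x : F | x != 0) x ^+ r * (x + 1) ^+ m) +
    chi (a * b) * (\sum_(x : F | x != 0) x ^+ (r + m) * (x + 1) ^+ m) -
    (-1) ^+ r * (1 + chi (- a)).
Proof.
move=> m oF nz_a nz_b m0 ndv; have F2 := two_neq0 F oF.
have mQ : (#|F|.-1 = 2 * m)%N by rewrite /m; lia.
have N1nz : (-1 : F) != 0 by rewrite oppr_eq0 oner_neq0.
have N11 : (1 == -1 :> F) = false.
  by apply/negP; rewrite -addr_eq0; apply/negP.
have N1_1 : (-1 == 1 :> F) = false by rewrite eq_sym.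
(* Non-divisibility by [m], not just by [2m], passes from [r] to [r + m], so both pure power sums
   vanish. *)
have sum0 n : ~~ (m %| n)%N -> \sum_(x : F | x != 0) x ^+ n = 0.
  move=> nd; apply: sum_expf0; apply: contra nd; rewrite mQ.
  by apply: dvdn_trans; apply: dvdn_mull.
have s1 := sum0 r ndv.
have s2 : \sum_(x : F | x != 0) x ^+ (r + m) = 0 by apply: sum0; rewrite dvdn_addl.
have chi0 : chi (0 : F) = 0 by rewrite /chi expr0n -/m eqn0Ngt m0.
pose g (x : F) := x ^+ r * ((1 + chi a * chi x) * (1 + chi b * chi (x + 1))).
have g_sum : \sum_(x | x != 0) g x =
    chi b * (\sum_(x : F | x != 0) x ^+ r * (x + 1) ^+ m) +
    chi (a * b) * (\sum_(x : F | x != 0) x ^+ (r + m) * (x + 1) ^+ m).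
  rewrite (eq_bigr (fun x => (x ^+ r + chi a * x ^+ (r + m)) +
      (chi b * (x ^+ r * (x + 1) ^+ m) +
       chi (a * b) * (x ^+ (r + m) * (x + 1) ^+ m)))) => [|x _].
    by rewrite !big_split -!big_distrr /= s1 s2 mulr0 !add0r.
  by rewrite /g chiM /chi -/m exprD; ring.
(* Since [chi 0 = 0], the last factor of [g] is [1] at [x = -1]; splitting off this term cancels the
   correction. *)
rewrite -g_sum [in RHS](bigD1 (-1)) //= [g (-1)]/g addNr chi0 mulr0 addr0 mulr1 -chiM mulrN1.
rewrite addrC addrK [RHS]big_mkcond [in LHS]big_mkcond big_distrr /=.
apply: eq_bigr => x _; rewrite inE.
(* Neither [0] nor [-1] lies in [Dset a b]: [chi 0 = 0], while [chi a] and [chi b] are [1] or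
   [-1]. *)
have [->|nz_x] := eqVneq x 0.
  by rewrite chi0; case: (chi_neq0 F a oF nz_a) => ->;
     rewrite ?[0 == _]eq_sym ?oner_eq0 ?(negPf N1nz) /= mulr0.
have [->|x1] := eqVneq x (-1).
  rewrite addNr chi0 andbC; case: (chi_neq0 F b oF nz_b) => ->;
     by rewrite ?[0 == _]eq_sym ?oner_eq0 ?(negPf N1nz) /= mulr0.
have nz_x1 : x + 1 != 0 by rewrite addr_eq0.
rewrite /= /g; case: (chi_neq0 F a oF nz_a) => ->; case: (chi_neq0 F b oF nz_b) => ->;
case: (chi_neq0 F x oF nz_x) => ->; case: (chi_neq0 F _ oF nz_x1) => ->;
by rewrite ?eqxx ?N11 ?N1_1 /=; ring.
Qed.

(** Of the two sums in [sum_Dset], one is minus a ['C(m, j)] with [j > m], hence [0]: the first for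
    exponent [l], the second for [q - 1 - l]. This is why [c] is [a * b] or [b]. *)
Lemma sum_Dset_bin (F : finFieldType) (a b : F) l (pos : bool) :
    let m := #|F|.-1./2 in
    odd #|F| -> a != 0 -> b != 0 -> (0 < l < m)%N ->
  \sum_(x in Dset a b) x ^+ (if pos then l else #|F|.-1 - l)%N =
    (1 + chi (- a) + (-1) ^+ l * chi (if pos then a * b else b) * 'C(m, l)%:R)
    / (4 * (-1) ^+ l.+1).
Proof.
move=> m oF nz_a nz_b lm; have F2 := two_neq0 F oF.
have mQ : (#|F|.-1 = 2 * m)%N by rewrite /m; lia.
have F4 : 4 != 0 :> F by rewrite (natrM _ 2 2) mulf_neq0.
have N1nz : (-1 : F) != 0 by rewrite oppr_eq0 oner_neq0.
have signQ : (-1) ^+ (if pos then l else #|F|.-1 - l)%N = (-1) ^+ l :> F.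
  case: pos => //; apply: (mulIf (expf_neq0 l N1nz)).
  rewrite -exprD subnK; last by lia.
  by rewrite expf_pred_card // -exprMn mulrNN mulr1 expr1n.
have key : 4 * \sum_(x in Dset a b) x ^+ (if pos then l else #|F|.-1 - l)%N =
    - (chi (if pos then a * b else b) * 'C(m, l)%:R) - (-1) ^+ l * (1 + chi (- a)).
  rewrite sum_Dset // -?/m ?signQ; [|lia|]; last first.
    case: pos {signQ}; first by rewrite gtnNdvd; lia.
    rewrite mQ; apply/negP; have -> : (2 * m - l = m + (m - l))%N by lia.
    by rewrite dvdn_addr // gtnNdvd; lia.
  congr (_ - _); case: pos {signQ}.
    rewrite !sum_expfM_exp1; try by lia.
    rewrite mQ ['C(m, 2 * m - l)]bin_small; last by lia.
    have -> : (2 * m - (l + m) = m - l)%N by lia.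
    by rewrite bin_sub; [ring|lia].
  rewrite sum_expfM_exp1; try by lia.
  rewrite (eq_bigr (fun x : F => x ^+ (m - l) * (x + 1) ^+ m)) => [|x nz_x]; last first.
    have -> : (#|F|.-1 - l + m = #|F|.-1 + (m - l))%N by lia.
    by rewrite exprD expf_pred_card // mul1r.
  rewrite sum_expfM_exp1; try by lia.
  have -> : (#|F|.-1 - (#|F|.-1 - l) = l)%N by lia.
  by rewrite ['C(m, #|F|.-1 - (m - l))]bin_small; [ring|lia].
apply: (mulfI F4); rewrite key exprS -signr_odd.
by case: (odd l); field; rewrite ?oppr_eq0.
Qed.

(** * Reduction of integer exponents modulo [q - 1] *)

(** With [q = 2m + 1], both [e1 * l1] and [e2 * l2] lie strictly between [-m] and [m], so their
    difference, a multiple of [2m], is [0]; positivity then fixes the sign. *)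
Lemma signed_residue_unique q k l1 e1 l2 e2 : odd q ->
  signed_residue q k l1 e1 -> signed_residue q k l2 e2 -> (l1, e1) = (l2, e2).
Proof.
move=> oq [h1 s1 r1] [h2 s2 r2]; have := etrans (esym h1) h2.
move/eqP; rewrite eqz_mod_dvd dvdzE.
have [m qE] : exists m, q = (2 * m).+1 by exists q./2; lia.
move: r1 r2 => {h1 h2}; rewrite qE /= mul2n doubleK => r1 r2.
set d := e1 * _ - _ => dv; have d0 : d = 0.
  apply/eqP; rewrite -absz_eq0 eqn0Ngt; apply/negP => /dvdn_leq /(_ dv).
  by rewrite /d; case: s1 s2 => -> [] ->; lia.
by move: d0; rewrite /d; case: s1 s2 => -> [] -> d0; try lia;
  have -> : l1 = l2 by lia.
Qed.

(** The remainder [s] of [k] modulo [2m] is neither [0] nor [m]; [l] is [s] if [s < m], and [2m - s]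
    with sign [-1] otherwise. *)
Lemma signed_residue_exists q k : odd q -> (1 < q)%N ->
    ~~ ((q.-1)./2%:Z %| k)%Z ->
  exists l e, signed_residue q k l e.
Proof.
move=> oq q1.
have [m qE] : exists m, q = (2 * m).+1 by exists q./2; lia.
have m0 : (0 < m)%N by lia.
rewrite /signed_residue qE /= mul2n doubleK => ndv.
set Q := m.*2%:Z; have Q0 : Q != 0 by rewrite /Q; lia.
have kE := divz_eq k Q; have r0 := modz_ge0 k Q0.
have rQ : (k %% Q)%Z < Q by apply: ltz_pmod; rewrite /Q; lia.
move: r0 rQ kE; set r := (k %% Q)%Z; set t := (k %/ Q)%Z => r0 rQ kE.
have [s rs] : exists s : nat, r = s%:Z by exists `|r|%N; lia.
have rm : s != 0%N /\ s != m.
  split; apply/eqP => sE; case/negP: ndv; apply/dvdzP.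
    by exists (2 * t); rewrite kE rs sE /Q; lia.
  by exists (2 * t + 1); rewrite kE rs sE /Q; lia.
have [lt|ge] := ltnP s m.
  exists s, 1; split; [|by left|lia].
  by rewrite mul1r -rs /r modz_mod.
exists (m.*2 - s)%N, (-1); split; [|by right|lia].
apply/eqP; rewrite eqz_mod_dvd; apply/dvdzP; exists (t + 1).
by rewrite kE rs /Q; lia.
Qed.

Lemma expfz_signed_residue (F : finFieldType) (x : F) k l e :
    x != 0 -> signed_residue #|F| k l e ->
  x ^ k = x ^+ (if e == 1 then l else #|F|.-1 - l)%N.
Proof.
move=> nz_x [/eqP]; rewrite eqz_mod_dvd => /dvdzP[t ht] he hl.
have -> : k = e * l%:Z + #|F|.-1%:Z * t by rewrite [_ * t]mulrC -ht; ring.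
rewrite expfzDr // -[x ^ (_ * t)]exprz_exp -exprnP expf_pred_card // exp1rz mulr1.
case: he => -> /=; first by rewrite mul1r.
rewrite mulN1r -invr_expz -exprnP; apply: (mulIf (expf_neq0 l nz_x)).
rewrite mulVf ?expf_neq0 // -exprD subnK; last first.
  by case/andP: hl => _ /ltnW /leq_trans; apply; rewrite -divn2 leq_div.
by rewrite expf_pred_card.
Qed.

Theorem theorem1p1 (F : finFieldType) (q : nat) (cardF : #|F| = q)
    (odd_q : odd q) (a b : F) (a_neq0 : a != 0) (b_neq0 : b != 0) :
  [/\ forall k : int, ~~ ((q.-1)./2%:Z %| k)%Z ->
        (exists! le : nat * int, signed_residue q k le.1 le.2) /\
        forall (l : nat) (eps : int), signed_residue q k l eps ->
          let c := if eps == 1 then a * b else b in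
          \sum_(x in Dset a b) x ^ k =
            (1 + chi (- a) + 2 ^- l * chi c *
               \sum_(0 <= i < (l./2).+1)
                  4 ^- i * 'C(l, 2 * i)%:R * 'C(2 * i, i)%:R)
            / (4 * (-1) ^+ l.+1),
      (3 < q)%N ->
        \sum_(x in Dset a b) x = (1 + chi (- a)) / 4 + chi (a * b) / 8
    & (5 < q)%N ->
        \sum_(x in Dset a b) x ^+ 2 =
          (- 1 - chi (- a)) / 4 - 3 * (chi (a * b) / 32)].
Proof.
have q1 : (1 < q)%N by rewrite -cardF finRing_gt1.
have oF : odd #|F| by rewrite cardF.
have F2 := two_neq0 F oF.
have F4 : 4 != 0 :> F by rewrite (natrM _ 2 2) mulf_neq0.
have F8 : 8 != 0 :> F by rewrite (natrM _ 2 4) mulf_neq0.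
have F32 : 32 != 0 :> F by rewrite (natrM _ 4 8) mulf_neq0.
have main k l eps : signed_residue q k l eps ->
    \sum_(x in Dset a b) x ^ k =
      (1 + chi (- a) + 2 ^- l * chi (if eps == 1 then a * b else b) *
         \sum_(0 <= i < (l./2).+1) 4 ^- i * 'C(l, 2 * i)%:R * 'C(2 * i, i)%:R)
      / (4 * (-1) ^+ l.+1).
  move=> hs; have [_ _ lm] := hs; rewrite -cardF in hs lm.
  rewrite (eq_bigr (fun x => x ^+ (if eps == 1 then l else #|F|.-1 - l)%N)); last first.
    (* Members of [Dset a b] are nonzero because [chi a <> 0], so negative powers are genuine
       inverses. *)
    move=> x; rewrite inE => /andP[/eqP xa _]; apply: expfz_signed_residue hs.
    by apply: contraNneq a_neq0 => x0; move: xa; rewrite x0 /chi expr0n;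
      case: eqP => [|_ /esym/eqP]; [lia | rewrite expf_eq0 => /andP[]].
  rewrite sum_Dset_bin //; congr ((_ + _) / _).
  set X := chi _; set m := #|F|.-1./2 in lm *.
  have N2 : 2 ^+ l != 0 :> F by rewrite expf_neq0.
  (* A further factor [2^l] makes the left side [(-4)^l 'C(m, l) = 'C(2l, l)], and [2^(l - 2i)] is
     [2^l 4^(-i)]. *)
  have binE : 2 ^+ l * (-1) ^+ l * 'C(m, l)%:R =
      \sum_(0 <= i < l./2.+1) 4 ^- i * 'C(l, 2 * i)%:R * 'C(2 * i, i)%:R :> F.
    apply: (mulfI N2); rewrite mulrA mulrA -!exprMn.
    have -> : 2 * 2 * -1 = -4 :> F by ring.
    rewrite bin_half_card //; last by lia.
    rewrite central_bin_sum big_distrr; apply: eq_big_nat => i /andP[_ il] /=.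
    rewrite !mulrA; congr (_ * _ * _).
    have -> : 4 ^+ i = 2 ^+ (2 * i) :> F by rewrite exprM; congr (_ ^+ _); ring.
    apply: (mulIf (expf_neq0 (2 * i) F2)).
    by rewrite mulfVK ?expf_neq0 // -exprD subnK //; lia.
  by apply: (mulfI N2); rewrite -binE !mulrA mulfV // mul1r; ring.
split.
- move=> k ndv; split; last exact: main.
  have [l [e hle]] := signed_residue_exists q k odd_q q1 ndv.
  exists (l, e); split=> // -[l' e'] hle'.
  exact: signed_residue_unique hle hle'.
(* An odd [q > 3] is at least [5], so [1 < (q - 1)/2]; likewise [q > 5] gives [2 < (q - 1)/2]
   below. *)
- move=> q3; have := main 1 1%N 1 ltac:(split; [by [] | by left | lia]).
  rewrite /= big_nat1 bin0 expr0 invr1 !mulr1 expr1 sqrrN expr1n => h.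
  rewrite (eq_bigr (fun x => x ^ 1)) // h.
  by field; rewrite F2 F4 F8.
- move=> q5; have := main 2 2%N 1 ltac:(split; [by [] | by left | lia]).
  rewrite /= big_nat_recr //= big_nat1 => h.
  rewrite (eq_bigr (fun x => x ^ 2)) // h.
  by rewrite muln0 !bin0 !binn bin1 muln1; field;
     rewrite oppr_eq0 F4 F32 oner_neq0.
Qed.
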